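(* There is no constant $C>0$ with the following property: for all $L>0$, $D>0$, $\sigma\ge0$, $L_\Delta\ge0$ with $L_\Delta\le L$, and all $\epsilon>0$, there is an adaptive randomized algorithm that makes at most $C\left(\frac{LD}{\sqrt\epsilon}+\frac{\sigma^2}{\epsilon}\right)$ oracle queries and whose output $\widehat z$ satisfies $\mathbb E[\mathcal R(\widehat z)^2]\le\epsilon$ on every admissible instance with parameters $(L,D,\sigma,L_\Delta)$ in $\mathcal H=\mathbb R^2$ with $A=0$. That is, even when restricted to two-dimensional monotone Lipschitz equations ($A=0$) with $L_\Delta\le L$, it is impossible to uniformly guarantee $\mathbb E[\mathcal R(\widehat z)^2]\le\epsilon$ using $O\left(\frac{LD}{\sqrt\epsilon}+\frac{\sigma^2}{\epsilon}\right)$ oracle queries, and this holds even when previously sampled stochastic operators may be queried repeatedly.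
   Context: An admissible instance with parameters $(L,D,\sigma,L_\Delta)$ in $\mathcal H=\mathbb R^2$ with $A=0$ consists of: a monotone, $L$-Lipschitz operator $F:\mathbb R^2\to\mathbb R^2$; an initial point $z_0$ such that some $z_\star$ with $F(z_\star)=0$ satisfies $\|z_0-z_\star\|\le D$; and a distribution of random operators $F_\xi=F+\delta_\xi$ with, for all $x,y,z\in\mathbb R^2$, $\mathbb E[\delta_\xi(z)]=0$, $\mathbb E\|\delta_\xi(z)\|^2\le\sigma^2$, and $\mathbb E\|\delta_\xi(x)-\delta_\xi(y)\|^2\le L_\Delta^2\|x-y\|^2$. The residual is $\mathcal R(z)=\operatorname{dist}(0,F(z)+A(z))$, which equals $\|F(z)\|$ when $A=0$. Oracle model: there is a sequence of i.i.d. sampled operators $F_{\xi^{(1)}},F_{\xi^{(2)}},\dots$. An adaptive randomized algorithm knows $z_0$ but accesses $F$ only through oracle queries: at each query it chooses a point $z$ and either a fresh sampled operator or any previously sampled one, based on its internal randomness (independent of the samples) and all previous observations, and it observes $F_{\xi^{(s)}}(z)$ for the chosen operator. Each evaluation $F_{\xi^{(s)}}(z)$ counts as one oracle query. After its queries it returns an output $\widehat z$; the expectation is over the samples and the internal randomness. *)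

(* Defs.v *)
From HB Require Import structures.
From mathcomp Require Import all_boot all_order all_algebra.
From mathcomp Require Import all_classical all_reals all_analysis.

Set Implicit Arguments.
Unset Strict Implicit.
Unset Printing Implicit Defensive.

Import Order.TTheory GRing.Theory Num.Theory.
Import numFieldNormedType.Exports.

Local Open Scope classical_set_scope.
Local Open Scope ring_scope.

(* The library norm on [R * R] is the sup norm, hence the explicit Euclidean
   structure; the sigma-algebra on [R * R] is the library's product one. *)
Notation plane R := (R * R)%type (only parsing).

Definition dotp (R : realType) (x y : plane R) : R := x.1 * y.1 + x.2 * y.2.

Definition enorm (R : realType) (x : plane R) : R := Num.sqrt (dotp x x).

Definition monotone_op (R : realType) (F : plane R -> plane R) : Prop :=
  forall x y, 0 <= dotp (F x - F y) (x - y).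

Definition lipschitz_op (R : realType) (L : R) (F : plane R -> plane R) : Prop :=
  forall x y, enorm (F x - F y) <= L * enorm (x - y).

(* dist(0, F(z) + A(z)) for A = 0 *)
Definition residual (R : realType) (F : plane R -> plane R) (z : plane R) : R :=
  enorm (F z).

Record problem (R : realType) := Problem {
  pb_op : plane R -> plane R;
  pb_start : plane R;
  pb_disp : measure_display;
  pb_index : measurableType pb_disp;
  pb_law : probability pb_index R;
  pb_noise : pb_index -> plane R -> plane R
}.

Definition sampled_op (R : realType) (I : problem R)
    (xi : pb_index I) (z : plane R) : plane R :=
  pb_op I z + pb_noise xi z.

(* Joint measurability of the noise makes the answer to a query at a random
   (history-dependent) point a random variable.  The bound on the second moment
   makes the noise integrable, so that its mean is a genuine one. *)
Definition admissible (R : realType) (L D sigma LDelta : R) (I : problem R)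
    : Prop :=
  [/\ monotone_op (pb_op I),
      lipschitz_op L (pb_op I),
      (exists zstar, pb_op I zstar = 0 /\ enorm (pb_start I - zstar) <= D),
      measurable_fun [set: pb_index I * plane R]
        (fun p => pb_noise p.1 p.2) &
   [/\ forall z, ('E_(pb_law I)[fun xi => (pb_noise xi z).1] = 0)%E /\
                 ('E_(pb_law I)[fun xi => (pb_noise xi z).2] = 0)%E,
       forall z, ('E_(pb_law I)[fun xi => (enorm (pb_noise xi z) ^+ 2)%R]
                  <= (sigma ^+ 2)%:E)%E &
       forall x y,
         ('E_(pb_law I)[fun xi =>
             (enorm (pb_noise xi x - pb_noise xi y) ^+ 2)%R]
          <= (LDelta ^+ 2 * enorm (x - y) ^+ 2)%:E)%E]].

(* The first argument of [al_sample], [al_point] and [al_output] is the known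
   initial point; before query [t] (from 0) the algorithm sees its internal
   randomness and the [t] answers received so far.  The past choices are
   functions of these data, so they are not recorded in the history.
   [al_budget] is the number of queries; an algorithm that may stop earlier is
   covered, since it can ignore the answers to its remaining queries.
   [al_sample] selects the operator to query: a value [k] smaller than the
   number [m] of operators drawn so far means the [k]-th of them, and any
   [k >= m] means a fresh one. *)
Record algorithm (R : realType) := Algorithm {
  al_disp : measure_display;
  al_rand : measurableType al_disp;
  al_law : probability al_rand R;
  al_budget : nat;
  al_sample : plane R -> forall t : nat, al_rand * t.-tuple (plane R) -> nat;
  al_point : plane R -> forall t : nat, al_rand * t.-tuple (plane R) -> plane R;
  al_output : plane R -> al_rand * al_budget.-tuple (plane R) -> plane R;
  al_sample_meas : forall z0 t, measurable_fun setT (@al_sample z0 t);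
  al_point_meas : forall z0 t, measurable_fun setT (@al_point z0 t);
  al_output_meas : forall z0, measurable_fun setT (al_output z0)
}.

(* Number of operators drawn, and answers received, after [t] queries; [G s] is
   the [s]-th sampled operator. *)
Fixpoint run (R : realType) (A : algorithm R) (z0 : plane R)
    (G : nat -> plane R -> plane R) (w : al_rand A) (t : nat)
    : nat * t.-tuple (plane R) :=
  match t with
  | 0 => (0%N, [tuple])
  | t'.+1 =>
      let: (m, h) := run z0 G w t' in
      let s := minn (al_sample z0 (w, h)) m in
      (maxn m s.+1, [tuple of rcons h (G s (al_point z0 (w, h)))])
  end.

Definition result (R : realType) (A : algorithm R) (z0 : plane R)
    (G : nat -> plane R -> plane R) (w : al_rand A) : plane R :=
  al_output z0 (w, (run z0 G w (al_budget A)).2).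

(* A probability space carrying the internal randomness of [A] and the sampled
   indices of [I].  The product rule says that all these variables are mutually
   independent, the first with law [al_law A], the others with law [pb_law I]. *)
Record execution (R : realType) (A : algorithm R) (I : problem R) := Execution {
  ex_disp : measure_display;
  ex_space : measurableType ex_disp;
  ex_prob : probability ex_space R;
  ex_rand : {mfun ex_space >-> al_rand A};
  ex_index : nat -> {mfun ex_space >-> pb_index I};
  ex_indep : forall (n : nat) (U : set (al_rand A)) (V : nat -> set (pb_index I)),
    measurable U -> (forall i, measurable (V i)) ->
    ex_prob (ex_rand @^-1` U `&` \bigcap_(i in `I_n) (ex_index i @^-1` V i))
    = (al_law A U * \prod_(i < n) pb_law I (V i))%E
}.

(* The value only depends on the joint law prescribed by [ex_indep]. *)
Definition expected_sq_residual (R : realType) (A : algorithm R) (I : problem R)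
    (X : execution A I) : \bar R :=
  ('E_(ex_prob X)[fun omega =>
     (residual (pb_op I)
        (result (pb_start I) (fun s => sampled_op (ex_index X s omega))
                (ex_rand X omega)) ^+ 2)%R])%E.

Definition solves (R : realType) (L D sigma LDelta eps : R) (A : algorithm R)
    : Prop :=
  forall I : problem R, admissible L D sigma LDelta I ->
  forall X : execution A I, (expected_sq_residual X <= eps%:E)%E.

(* Main.v *)
From HB Require Import structures.
Require Import Defs.
From mathcomp Require Import all_boot all_order all_algebra.
From mathcomp Require Import all_classical all_reals all_analysis.
From mathcomp Require Import measurable_realfun ring lra.
Import Order.TTheory GRing.Theory Num.Theory.
Import numFieldNormedType.Exports.
Local Open Scope ring_scope.
Local Open Scope classical_set_scope.

Set Implicit Arguments.
Unset Strict Implicit.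
Unset Printing Implicit Defensive.

(** The operators depend on the first coordinate only.  For [j <= n], the [j]-th
    one is the piecewise linear function equal to [-theta] at the integers
    below [j], to [0] at [j] and to [theta] above [j]; a residual below
    [theta / 2] determines [j].  A sampled operator interpolates independent
    signs at the integers, the sign at [k] having as mean the value at [k] of
    the [j]-th operator, so a query reveals at most two signs of one sample, and
    repeated queries to a sample bring nothing but further independent signs.
    With respect to fair signs, each revealed sign multiplies the second moment
    of the likelihood ratio by at most [1 + theta^2].  Hence, if the [n + 1]
    problems are all solved with probability [3 / 4] by [T] queries, then
    [n + 1 <= 2 (1 + theta^2)^(2 T)].  For [theta = 1 / (n + 1)] the claimed
    budget is [T <= 80 C / theta^2], and the right-hand side stays below
    [2 exp (160 C)] as [n] grows. *)

(** * Decision trees over independent bits *)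

Definition mean {R : realFieldType} {I : finType} (p : I -> bool -> R)
    (phi : {ffun I -> bool} -> R) : R :=
  \sum_(w : {ffun I -> bool}) (\prod_c p c (w c)) * phi w.

Definition condition {R : realFieldType} {I : finType} (p : I -> bool -> R)
    (c : I) (b : bool) : I -> bool -> R :=
  fun c' b' => if c' == c then (b' == b)%:R else p c' b'.

(** A tree is represented by the function that it computes. Leaves are allowed for every [m], so [m]
    is only an upper bound on the number of revealed bits. *)
Inductive decision_tree {R : realFieldType} {I : finType} :
    nat -> ({ffun I -> bool} -> R) -> Prop :=
| dt_leaf m a : decision_tree m (fun=> a)
| dt_query m c k : (forall b, decision_tree m (k b)) ->
    decision_tree m.+1 (fun w => k (w c) w).

Section decision_trees.
Context {R : realFieldType} {I : finType}.
Implicit Types (p q : I -> bool -> R) (c : I) (phi : {ffun I -> bool} -> R).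

(** This is the law of total expectation. As [condition p c b] is a point mass at [c], a given [w]
    only contributes to the term [b = w c]. *)
Lemma mean_query p c (k : bool -> {ffun I -> bool} -> R) :
  mean p (fun w => k (w c) w) = \sum_b p c b * mean (condition p c b) (k b).
Proof.
rewrite /mean; under [RHS]eq_bigr do rewrite big_distrr /=.
rewrite exchange_big; apply: eq_bigr => w _ /=.
rewrite [RHS](bigD1 (w c)) //= [X in _ + X]big1 => [|b /negPf nb]; last first.
  by rewrite (bigD1 c) //= /condition eqxx eq_sym nb !mul0r mulr0.
rewrite addr0 (bigD1 c) //= [in RHS](bigD1 c) //= /condition !eqxx mul1r mulrA.
by congr (_ * _ * _); apply: eq_bigr => c' /negPf ->.
Qed.

Lemma mean_cst p (a : R) : (forall c, \sum_b p c b = 1) ->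
  mean p (fun=> a) = a.
Proof.
move=> p1; rewrite /mean -big_distrl /= -(bigA_distr_bigA p).
by rewrite big1 ?mul1r// => c _; exact: p1.
Qed.

Lemma condition_sum1 p c b : (forall c', \sum_b p c' b = 1) ->
  forall c', \sum_b' condition p c b c' b' = 1.
Proof.
move=> p1 c'; rewrite /condition; case: eqP => // _.
by rewrite big_bool /=; case: b; rewrite ?addr0 ?add0r.
Qed.

(* Once a bit is revealed its weights become a point mass, for which [pq] holds
   with the factor [1 <= M]; quantifying over all product weights thus makes the
   induction go through even if a tree queries the same bit again. *)
Lemma decision_tree_mean_sqr {m : nat} {phi} (M : R) p q :
  decision_tree m phi -> 1 <= M ->
  (forall c, \sum_b p c b = 1) -> (forall c, \sum_b q c b = 1) ->
  (forall c b, 0 <= q c b) ->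
  (forall c (x : bool -> R),
    (\sum_b p c b * x b) ^+ 2 <= M * \sum_b q c b * x b ^+ 2) ->
  mean p phi ^+ 2 <= M ^+ m * mean q (fun w => phi w ^+ 2).
Proof.
move=> tree M1; elim: tree p q => {m phi} [m a|m c k _ IH] p q p1 q1 q0 pq.
  by rewrite !mean_cst// ler_peMl ?sqr_ge0// exprn_ege1.
rewrite mean_query (mean_query q c (fun b w => k b w ^+ 2)).
apply: le_trans (pq c _) _; rewrite exprS -mulrA ler_wpM2l ?(le_trans ler01)//.
rewrite big_distrr; apply: ler_sum => b _; rewrite [leRHS]mulrCA ler_wpM2l//.
apply: IH.
- exact: condition_sum1.
- exact: condition_sum1.
- by move=> c' b'; rewrite /condition; case: ifP.
move=> c' x.
rewrite /condition; case: (c' =P c) => // _; rewrite !big_bool /=.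
have: 0 <= x b ^+ 2 by exact: sqr_ge0.
by case: b => /= xb; rewrite !(mul1r, mul0r, addr0, add0r) ler_peMl.
Qed.

End decision_trees.

(** The recursion of [run] exposes the last query, whereas a tree branches on the first bit. Hence
    the continuation [psi], a tree grown from the final state: the induction absorbs the last query
    into it, at the cost of two bits. *)
Lemma run_decision_tree {R : realType} {I : finType} (A : algorithm R)
    (z0 : R * R) (G : {ffun I -> bool} -> nat -> R * R -> R * R)
    (w : al_rand A) (t m : nat)
    (psi : nat * t.-tuple (R * R) -> {ffun I -> bool} -> R) :
  (forall s z, exists c1 c2 (g : bool -> bool -> R * R),
    forall b, G b s z = g (b c1) (b c2)) ->
  (forall s, decision_tree m (psi s)) ->
  decision_tree (t.*2 + m) (fun b : {ffun I -> bool} => psi (run z0 (G b) w t) b).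
Proof.
move=> G2; elim: t m psi => [|t IH] m psi psim; first exact: psim.
rewrite doubleS !addSn -!addnS.
pose step (st : nat * t.-tuple (R * R)) b :=
  let: (k, h) := st in
  let s := minn (al_sample z0 (w, h)) k in
  (maxn k s.+1, [tuple of rcons h (G b s (al_point z0 (w, h)))]).
have -> : (fun b : {ffun I -> bool} => psi (run z0 (G b) w t.+1) b) =
          (fun b => (fun st b => psi (step st b) b) (run z0 (G b) w t) b).
  by apply/funext => b /=; case: (run z0 (G b) w t).
apply: (IH m.+2 (fun st b => psi (step st b) b)) => -[k h]; rewrite /step /=.
have [c1 [c2 [g Gg]]] := G2 (minn (al_sample z0 (w, h)) k) (al_point z0 (w, h)).
under eq_fun do rewrite Gg.
set st := fun b1 b2 => (maxn k (minn (al_sample z0 (w, h)) k).+1,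
  [tuple of rcons h (g b1 b2)]).
apply: (@dt_query _ _ m.+1 c1 (fun b1 b => psi (st b1 (b c2)) b)) => b1.
by apply: (@dt_query _ _ m c2 (fun b2 b => psi (st b1 b2) b)) => b2.
Qed.

(** * Piecewise linear functions with nodes at the integers *)

(** Clamping at 0 extends the function by [v 0] to negative numbers, so that the nodes are indexed
    by [nat]. *)
Definition interp {R : realType} (v : nat -> R) (x : R) : R :=
  let y := Num.max 0 x in let k := Num.truncn y in
  v k + (v k.+1 - v k) * (y - k%:R).

(** The values are constant from [n] on, so that finitely many coins, at the nodes 0 to [n],
    describe a sample. *)
Definition bias {R : realType} (theta : R) (n j k : nat) : R :=
  if (minn k n < j)%N then - theta
  else if minn k n == j then 0 else theta.

Definition nearest {R : realType} (n : nat) (x : R) : nat :=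
  let y := Num.max 0 x in let k := Num.truncn y in
  minn (if y - k%:R <= 2^-1 then k else k.+1) n.

Section interpolation.
Context {R : realType}.
Implicit Types (v : nat -> R) (x y : R).

Lemma interp_itv v x (k := Num.truncn (Num.max 0 x)) : exists2 r : R,
  0 <= r < 1 & Num.max 0 x = k%:R + r /\ interp v x = v k * (1 - r) + v k.+1 * r.
Proof.
exists (Num.max 0 x - k%:R).
  have : k%:R <= Num.max 0 x < k.+1%:R by rewrite truncn_itv// le_max lexx.
  by rewrite -natr1 => /andP[? ?]; apply/andP; split; lra.
by rewrite /interp -/k; split; ring.
Qed.

(** Inside one cell the function is affine and nondecreasing; for distinct cells, [v k.+1 <= v l]
    separates the two values. *)
Lemma interp_homo v : {homo v : i j / (i <= j)%N >-> i <= j} ->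
  {homo interp v : x y / x <= y}.
Proof.
move=> vh x y xy.
have := interp_itv v x; set k := Num.truncn _ => -[r r01 [xr ->]].
have := interp_itv v y; set l := Num.truncn _ => -[s s01 [ys ->]].
have mxy : Num.max 0 x <= Num.max 0 y by rewrite ge_max !le_max lexx xy orbT.
have kl : (k <= l)%N by apply: le_truncn.
have hk : v k <= v k.+1 by exact: vh.
have hl : v l <= v l.+1 by exact: vh.
move: kl; rewrite leq_eqVlt => /predU1P[kl|/vh vkl].
  rewrite kl in xr hk *; nra.
nra.
Qed.

Lemma interp_affine v a b x : interp (fun k => a * k%:R + b * v k) x =
  a * Num.max 0 x + b * interp v x.
Proof. by rewrite /interp; set k := Num.truncn _; rewrite -natr1; ring. Qed.

(** The sequences [a * k + v k] and [a * k - v k] are nondecreasing, hence so are their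
    interpolations. This gives both inequalities without comparing the cells of [x] and [y]. *)
Lemma interp_lipschitz v (a : R) x y : (forall k, `|v k.+1 - v k| <= a) ->
  `|interp v x - interp v y| <= a * `|x - y|.
Proof.
move=> va; wlog xy : x y / x <= y.
  by move=> h; have [/h//|/ltW/h] := leP x y; rewrite distrC (distrC y).
have a0 : 0 <= a by exact: le_trans (va 0%N).
have mono b : `|b| = 1 ->
    {homo (fun k => a * k%:R + b * v k) : i j / (i <= j)%N >-> i <= j}.
  move=> b1; apply/nondecreasing_seqP => k; rewrite -natr1.
  have : `|b * (v k.+1 - v k)| <= a by rewrite normrM b1 mul1r.
  by rewrite ler_norml => /andP[]; lra.
have := interp_homo (mono 1 (normr1 _)) xy.
have := interp_homo (mono (-1) (normrN1 _)) xy.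
have mxy : Num.max 0 y - Num.max 0 x <= y - x.
  by rewrite /Num.max; case: (ltP 0 x); case: (ltP 0 y); lra.
have : a * (Num.max 0 y - Num.max 0 x) <= a * (y - x) by exact: ler_wpM2l.
rewrite !interp_affine distrC (distrC x) (ger0_norm (_ : 0 <= y - x)) ?subr_ge0//.
by move=> *; rewrite ler_norml; apply/andP; split; lra.
Qed.

Lemma interpB u v x : interp u x - interp v x = interp (fun k => u k - v k) x.
Proof. by rewrite /interp; ring. Qed.

Lemma interp_bounded v (a : R) x : (forall k, `|v k| <= a) -> `|interp v x| <= a.
Proof.
move=> va; have [r /andP[r0 r1] [_ ->]] := interp_itv v x.
set k := Num.truncn _; have := va k; have := va k.+1; rewrite !ler_norml.
by move=> /andP[? ?] /andP[? ?]; apply/andP; split; nra.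
Qed.

Lemma bias_homo (theta : R) n j : 0 <= theta ->
  {homo bias theta n j : i k / (i <= k)%N >-> i <= k}.
Proof.
move=> t0 i k ik; have : (minn i n <= minn k n)%N.
  by rewrite leq_min !geq_min ik leqnn orbT.
rewrite /bias; case: (ltngtP (minn i n) j); case: (ltngtP (minn k n) j) => //=;
  try by move=> *; lra.
- by move=> h1 h2 h3; have := leq_ltn_trans h3 h1; rewrite ltnNge ltnW.
- by move=> h1 h2 h3; move: h3; rewrite h1 leqNgt h2.
- by move=> h1 h2; rewrite h2 leqNgt h1.
Qed.

Lemma bias_le (theta : R) n j k : 0 <= theta -> `|bias theta n j k| <= theta.
Proof.
by move=> t0; rewrite /bias; do 2?case: ifP => _; rewrite ?normrN ?normr0 ?ger0_norm.
Qed.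

(** The capped index grows by at most one, so it cannot skip [j], where the value is 0, and never
    jumps from [- theta] to [theta]. *)
Lemma bias_incr (theta : R) n j k : 0 <= theta ->
  `|bias theta n j k.+1 - bias theta n j k| <= theta.
Proof.
move=> t0; have := bias_homo n j t0 (leqnSn k); rewrite -subr_ge0 => h.
rewrite ger0_norm//; move: h; rewrite /bias.
have : (minn k.+1 n <= (minn k n).+1)%N.
  by rewrite -minnSS leq_min !geq_min leqnn leqnSn orbT.
case: (ltngtP (minn k n) j); case: (ltngtP (minn k.+1 n) j) => //=;
  try by move=> *; lra.
by move=> h1 h2 h3; have := leq_trans h1 h3; rewrite ltnS leqNgt h2.
Qed.

(** The nearest node has value [- theta] or [theta] and weight at least one half. The other end of
    the cell cannot have the opposite sign, since [j] would then lie strictly between consecutive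
    nodes. *)
Lemma interp_bias_far (theta : R) n j x : 0 <= theta -> (j <= n)%N ->
  nearest n x != j -> (theta / 2) ^+ 2 <= interp (bias theta n j) x ^+ 2.
Proof.
move=> t0 jn; have := interp_itv (bias theta n j) x; rewrite /nearest.
set k := Num.truncn _ => -[r /andP[r0 r1] [-> ->]].
have -> : k%:R + r - k%:R = r by ring.
have := bias_homo n j t0 (leqnSn k).
have := bias_le n j k t0; have := bias_le n j k.+1 t0; rewrite !ler_norml.
move=> /andP[b1 b1'] /andP[b0 b0'] b01.
have lo i : (minn i n < j)%N -> bias theta n j i = - theta by rewrite /bias => ->.
have hi i : (j < minn i n)%N -> bias theta n j i = theta.
  by move=> h; rewrite /bias ltnNge (ltnW h) (gtn_eqF h).
have ge0 i : (j < minn i.+1 n)%N -> 0 <= bias theta n j i.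
  rewrite /bias => h; rewrite ltnNge.
  have -> /= : (j <= minn i n)%N by move: h; rewrite !leq_min ltnS => /andP[-> /ltnW].
  by case: ifP.
have le0 i : (minn i n < j)%N -> bias theta n j i.+1 <= 0.
  move=> h; rewrite /bias.
  have : (minn i.+1 n <= j)%N.
    by apply: leq_trans h; rewrite -minnSS leq_min !geq_min leqnn leqnSn orbT.
  by rewrite leq_eqVlt => /predU1P[->|->]; rewrite ?ltnn ?eqxx// oppr_le0.
suff h (z : R) : z <= - (theta / 2) \/ theta / 2 <= z -> (theta / 2) ^+ 2 <= z ^+ 2.
  rewrite neq_ltn; case: (leP r 2^-1) => hr /orP[] hj; apply: h.
  - by left; have := le0 _ hj; rewrite (lo k)//; nra.
  - right; rewrite (hi k)// (hi k.+1) ?mulr1; first by lra.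
    by apply: leq_trans hj _; rewrite leq_min !geq_min leqnSn leqnn orbT.
  - left; rewrite (lo k.+1)// (lo k); first by lra.
    by apply: leq_ltn_trans hj; rewrite leq_min !geq_min leqnSn leqnn orbT.
  - by right; have := ge0 _ hj; rewrite (hi k.+1)//; nra.
by case=> ?; nra.
Qed.

Lemma continuous_interp v (a : R) : (forall k, `|v k.+1 - v k| <= a) ->
  continuous (interp v).
Proof.
move=> va x; have a0 : 0 <= a by exact: le_trans (va 0%N).
apply/cvgrPdist_lt => e e0.
near=> y; rewrite (le_lt_trans (interp_lipschitz _ _ va))//.
(* Unlike [a], the factor [a + 1] is always positive, so the radius can be divided by it. *)
apply: (@le_lt_trans _ _ ((a + 1) * `|x - y|)); first by rewrite ler_wpM2r// lerDl.
rewrite mulrC -ltr_pdivlMr ?ltr_wpDl//.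
near: y; apply: cvgr_dist_lt => //.
by rewrite divr_gt0// ltr_wpDl.
Unshelve. all: by end_near. Qed.

(** Only [j = nearest n x] can pass the test: one output is good for at most one of the [n + 1]
    operators. *)
Lemma sum_close_le1 (theta : R) n x : 0 <= theta ->
  \sum_(j < n.+1) (interp (bias theta n j) x ^+ 2 < (theta / 2) ^+ 2)%R%:R <= 1 :> R.
Proof.
move=> t0; have hn : (nearest n x < n.+1)%N by rewrite ltnS geq_minr.
rewrite (bigD1 (Ordinal hn)) //= big1 ?addr0 ?lern1 ?leq_b1// => j.
rewrite -val_eqE /= eq_sym => /(interp_bias_far t0 (ltn_ord j : (j <= n)%N)).
by rewrite ltNge => ->.
Qed.

End interpolation.

(** * Finite and countable case analysis for measures and measurable functions *)

Lemma measure_fibers d (T : measurableType d) (R : realType)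
    (mu : {measure set T -> \bar R}) (I : finType) (f : T -> I) (A : set T) :
  measurable A -> (forall i, measurable (f @^-1` [set i])) ->
  mu A = (\sum_i mu (A `&` f @^-1` [set i]))%E.
Proof.
move=> mA mf; rewrite fsbig_seq ?index_enum_uniq// -measure_fin_bigcup//.
- congr (mu _); apply/seteqP; split=> [x Ax|x [i _ []]//].
  by exists (f x) => //=; rewrite mem_index_enum.
- by move=> i j _ _ [x [[_ /= <-] [_ /= <-]]].
- by move=> i _; apply: measurableI.
Qed.

Lemma measurable_uncurry_nat d d' (T : measurableType d) (T' : measurableType d')
    (g : nat -> T -> T') : (forall k, measurable_fun setT (g k)) ->
  measurable_fun setT (fun p => g p.1 p.2).
Proof.
move=> mg _ Y mY; rewrite setTI.
have -> : (fun p => g p.1 p.2) @^-1` Y = \bigcup_k ([set k] `*` (g k @^-1` Y)).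
  apply/seteqP; split=> [[k x] /= Yx|[_ x] [k _ [/= -> //]]].
  by exists k.
apply: bigcup_measurable => k _; apply: measurableX => //.
by rewrite -[_ @^-1` _]setTI; exact: mg.
Qed.

Lemma measurable_fun_nat_arg d d' d'' (X : measurableType d)
    (T : measurableType d') (T' : measurableType d'') (g : nat -> T -> T')
    (f : X -> nat) (h : X -> T) : (forall k, measurable_fun setT (g k)) ->
  measurable_fun setT f -> measurable_fun setT h ->
  measurable_fun setT (fun x => g (f x) (h x)).
Proof.
move=> mg mf mh; rewrite (_ : (fun _ => _) =
  (fun p => g p.1 p.2) \o (fun x => (f x, h x)))//.
apply: measurableT_comp; [exact: measurable_uncurry_nat|].
exact: measurable_fun_pair.
Qed.

(** * Finite laws on the integers, and independent draws from them on the unit interval *)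

Section finite_law.
Context {R : realType} (K : nat) (p : nat -> R).

(** The absolute value provides the nonnegativity that [mscale] asks for, so that this is a measure
    before any hypothesis on [p] is made. *)
Definition finite_law : set nat -> \bar R :=
  msum (fun k => mscale `|p k|%:nng (\d_k : {measure set nat -> \bar R})) K.

HB.instance Definition _ := Measure.on finite_law.

Hypothesis p_gt0 : forall k, 0 < p k.

Lemma finite_lawE (V : set nat) :
  finite_law V = (\sum_(k < K | (k : nat) \in V) p k)%:E.
Proof.
rewrite /finite_law /msum -sumEFin [RHS]big_mkcond /=; apply: eq_bigr => k _.
rewrite /mscale /= diracE ger0_norm ?(ltW (p_gt0 _))//.
by case: (_ \in V); rewrite ?mule1 ?mule0.
Qed.

Lemma ge0_integral_finite_law (g : nat -> R) : (forall k, 0 <= g k) ->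
  (\int[finite_law]_k (g k)%:E = (\sum_(k < K) p k * g k)%:E)%E.
Proof.
move=> g0; rewrite /finite_law ge0_integral_measure_sum//; last first.
  by move=> k _; rewrite lee_fin.
rewrite -sumEFin; apply: eq_bigr => k _.
rewrite ge0_integral_mscale//=; last by move=> i _; rewrite lee_fin.
by rewrite integral_dirac// diracT mul1e ger0_norm ?(ltW (p_gt0 _)).
Qed.

Lemma integral_finite_law (g : nat -> R) :
  (\int[finite_law]_k (g k)%:E = (\sum_(k < K) p k * g k)%:E)%E.
Proof.
rewrite integralE.
have gp := @ge0_integral_finite_law (fun k => Num.max (g k) 0).
have gn := @ge0_integral_finite_law (fun k => Num.max (- g k) 0).
rewrite [X in (X - _)%E](eq_integral (fun k => (Num.max (g k) 0)%:E)); last first.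
  by move=> k _; rewrite funeposE EFin_max.
rewrite [X in (_ - X)%E](eq_integral (fun k => (Num.max (- g k) 0)%:E)); last first.
  by move=> k _; rewrite funenegE -EFinN EFin_max.
rewrite gp ?gn; [|by move=> k; rewrite le_max lexx orbT..].
rewrite -EFinB -sumrB; congr EFin; apply: eq_bigr => k _; rewrite -mulrBr.
by congr (_ * _); rewrite /Num.max; case: (ltP (g k) 0); case: (ltP (- g k) 0); lra.
Qed.

End finite_law.

(* [letter i u] is the [i]-th digit of [u] for the expanding map [shift] of
   [0, 1[ whose [k]-th branch has length [p k].  The numbers with prescribed
   first digits form an interval, whose length is the product of the weights of
   these digits: under the uniform law the letters are independent of law [p]. *)
Section digits.
Context {R : realType} (K : nat) (p : nat -> R).

Definition cdf (k : nat) : R := \sum_(i < k) p i.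

(** Counting thresholds defines the digit of every real number and makes it measurable as a sum of
    comparisons. *)
Definition digit (u : R) : nat := \sum_(k < K) (cdf k.+1 <= u)%R.

Definition shift (u : R) : R := (u - cdf (digit u)) / p (digit u).

Definition letter (i : nat) (u : R) : nat := digit (iter i shift u).

Lemma cdfS k : cdf k.+1 = cdf k + p k.
Proof. by rewrite /cdf big_ord_recr. Qed.

Lemma measurable_digit : measurable_fun setT digit.
Proof.
rewrite /digit; elim: K => [|k IH].
  rewrite (_ : (fun _ => _) = cst 0%N)//.
  by apply/funext => u; rewrite big_ord0.
rewrite (_ : (fun _ => _) = (fun z => addn z.1 z.2) \o
    (fun u => ((\sum_(j < k) (cdf j.+1 <= u)%R)%N, nat_of_bool (cdf k.+1 <= u)%R))); last first.
  by apply/funext => u; rewrite big_ord_recr.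
apply: measurableT_comp; first exact: measurable_uncurry_nat.
apply: measurable_fun_pair => //.
apply: (measurableT_comp (f := nat_of_bool)) => //.
exact: measurable_fun_ler.
Qed.

Lemma measurable_letter i : measurable_fun setT (letter i).
Proof.
apply: measurableT_comp; first exact: measurable_digit.
elim: i => [|i IH]; first exact: measurable_id.
apply: (measurableT_comp (f := shift)) => //; rewrite /shift.
apply: measurable_funM; last first.
  apply: (measurableT_comp (f := fun k => (p k)^-1)) => //.
  exact: measurable_digit.
apply: measurable_funB => //.
by apply: (measurableT_comp (f := cdf)) => //; exact: measurable_digit.
Qed.

Hypothesis p_gt0 : forall k, 0 < p k.
Hypothesis p_sum1 : \sum_(k < K) p k = 1.

Lemma cdf_homo : {homo cdf : i j / (i <= j)%N >-> i <= j}.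
Proof. by apply/nondecreasing_seqP => k; rewrite cdfS lerDl ltW. Qed.

Lemma digit_uniq u d : (d < K)%N -> cdf d <= u < cdf d.+1 -> digit u = d.
Proof.
move=> dK /andP[du ud]; rewrite /digit.
rewrite (eq_bigr (fun k : 'I_K => nat_of_bool (k < d)%N)); last first.
  move=> k _; congr nat_of_bool; case: ltnP => [/cdf_homo/le_trans->//|dk].
  by apply/negbTE; rewrite -ltNge (lt_le_trans ud)// cdf_homo.
rewrite -(big_mkord predT (fun k => nat_of_bool (k < d)%N))
  (big_cat_nat (leq0n d) (ltnW dK))/=.
rewrite [X in (_ + X)%N]big_nat_cond [X in (_ + X)%N]big1 ?addn0; last first.
  by move=> k /andP[/andP[dk _] _]; rewrite ltnNge dk.
rewrite big_nat_cond (eq_bigr (fun=> 1%N)); last first.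
  by move=> k /andP[/andP[_ ->]].
by rewrite -big_nat_cond sum_nat_const_nat muln1 subn0.
Qed.

Lemma digit_itv u : 0 <= u < 1 ->
  (digit u < K)%N /\ cdf (digit u) <= u < cdf (digit u).+1.
Proof.
move=> /andP[u0 u1].
have uK : u < cdf K by rewrite /cdf p_sum1.
have K0 : (0 < K)%N.
  by rewrite lt0n; apply: contraTneq uK => ->; rewrite /cdf big_ord0 -leNgt.
have ex : exists k, (fun k => u < cdf k.+1) k by exists K.-1; rewrite prednK.
case: (ex_minnP ex) => d ud dmin.
have dK : (d < K)%N by rewrite -(prednK K0) ltnS dmin// prednK.
suff h : cdf d <= u < cdf d.+1 by rewrite (digit_uniq dK h).
rewrite ud andbT leNgt; case: d ud dmin {dK} => [_ _|d ud dmin].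
  by rewrite /cdf big_ord0 -leNgt.
by apply/negP => /dmin; rewrite ltnn.
Qed.

Lemma shift_itv u : 0 <= u < 1 -> 0 <= shift u < 1.
Proof.
move=> /digit_itv[_]; rewrite cdfS /shift => /andP[? ?].
by rewrite ltr_pdivrMr// mul1r ltrBlDl divr_ge0 ?subr_ge0// ltW.
Qed.

(** The branch [d] of [shift] has the affine inverse [x |-> cdf d + p d * x]; composing these
    inverses maps [0, 1[ onto the interval with this left end. *)
Fixpoint cylinder_start (ds : seq nat) : R :=
  if ds is d :: ds' then cdf d + p d * cylinder_start ds' else 0.

Fixpoint cylinder_length (ds : seq nat) : R :=
  if ds is d :: ds' then p d * cylinder_length ds' else 1.

Definition cylinder (ds : seq nat) : set R :=
  [set u | 0 <= u < 1 /\ forall i, (i < size ds)%N -> letter i u = nth 0%N ds i].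

Lemma cylinderE ds : all (ltn^~ K) ds ->
  cylinder ds = `[cylinder_start ds, cylinder_start ds + cylinder_length ds[.
Proof.
elim: ds => [_|d ds IH /= /andP[dK /IH{}IH]].
  by apply/seteqP; split=> u; rewrite /cylinder/= in_itv/= add0r => // -[].
(* Being an equality of sets, the induction hypothesis also tells that the interval lies in [0,
   1[. *)
have bnd (u : R) : cylinder_start ds <= u < cylinder_start ds + cylinder_length ds ->
    0 <= u < 1.
  by move=> h; have : cylinder ds u; [rewrite IH/= in_itv|case].
apply/seteqP; split=> u; rewrite /= in_itv/=.
- move=> [u01 hu]; have [_] := digit_itv u01.
  have ud : digit u = d by exact: (hu 0%N).
  have : cylinder ds (shift u).
    split; first exact: shift_itv.
    by move=> i id; have := hu i.+1 id; rewrite /letter iterSr.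
  rewrite IH/= in_itv/= /shift ud ler_pdivlMr// ltr_pdivrMr// => /andP[? ?] _.
  by apply/andP; split; lra.
- move=> /andP[u1 u2].
  have h : cylinder_start ds <= (u - cdf d) / p d < cylinder_start ds + cylinder_length ds.
    by rewrite ler_pdivlMr// ltr_pdivrMr//; apply/andP; split; lra.
  have /andP[h0 h1] := bnd _ h.
  have hu : cdf d <= u < cdf d.+1.
    move: h0 h1; rewrite ler_pdivlMr// ltr_pdivrMr// cdfS => *.
    by apply/andP; split; lra.
  have ud := digit_uniq dK hu.
  have : cylinder ds (shift u) by rewrite IH/= in_itv/= /shift ud.
  move=> [_ hs]; split.
    move/andP: hu => [hu1 hu2]; apply/andP; split.
      by apply: le_trans hu1; rewrite sumr_ge0// => i _; exact: ltW.
    by rewrite (lt_le_trans hu2)// -p_sum1; exact: cdf_homo.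
  by case=> [_|i id]; [exact: ud|rewrite /letter iterSr; exact: hs].
Qed.

Let U := @uniform_prob R 0 1 ltr01.

Lemma uniform_prob_sub01 (A : set R) : measurable A -> A `<=` `[0, 1] ->
  U A = lebesgue_measure A.
Proof.
move=> mA A01; rewrite /U /uniform_prob.
rewrite (eq_integral (fun=> 1%E)) ?integral_cst ?mul1e// => x.
by rewrite inE => /A01/=; rewrite in_itv/= /uniform_pdf => ->; rewrite subr0 invr1.
Qed.

Lemma uniform_prob_cylinder ds : all (ltn^~ K) ds ->
  U (cylinder ds) = (cylinder_length ds)%:E.
Proof.
move=> dsK; rewrite uniform_prob_sub01.
- rewrite cylinderE// lebesgue_measure_itv/= lte_fin.
  have l0 : 0 < cylinder_length ds.
    by elim: ds {dsK} => //= d ds; exact: mulr_gt0.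
  by rewrite ltrDl l0 -EFinB addrC addKr.
- by rewrite cylinderE.
- by move=> u [/andP[u0 u1] _] /=; rewrite in_itv/= u0 ltW.
Qed.

Lemma cylinder_length_rcons ds d :
  cylinder_length (rcons ds d) = cylinder_length ds * p d.
Proof. by elim: ds => [|e ds /= ->]; rewrite /= ?mulr1 ?mul1r ?mulrA. Qed.

Lemma cylinder_rcons ds d :
  cylinder (rcons ds d) = cylinder ds `&` letter (size ds) @^-1` [set d].
Proof.
apply/seteqP; split=> [u [u01]|u [[u01 h] /= hd]]; last first.
  split=> // i; rewrite size_rcons ltnS leq_eqVlt nth_rcons => /predU1P[->|id].
    by rewrite ltnn eqxx.
  by rewrite id h.
rewrite size_rcons => h; split; first split => // i id.
  by have := h i (leqW id); rewrite nth_rcons id.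
by have := h _ (ltnSn (size ds)); rewrite nth_rcons ltnn eqxx.
Qed.

Lemma measurable_letter_in i (V : set nat) : measurable (letter i @^-1` V).
Proof. by rewrite -[_ @^-1` _]setTI; exact: measurable_letter. Qed.

Lemma letter_lt i u : 0 <= u < 1 -> (letter i u < K)%N.
Proof.
move=> u01; have : 0 <= iter i shift u < 1 by elim: i => //= i /shift_itv.
by move=> /digit_itv[].
Qed.

(** The prefix [ds] is there for the induction on [n]: splitting along the next letter yields
    cylinders with one more digit and one constraint less. *)
Lemma uniform_prob_letters n ds (V : nat -> set nat) : all (ltn^~ K) ds ->
  U (cylinder ds `&` \bigcap_(i in `I_n) (letter (size ds + i) @^-1` V i)) =
  (cylinder_length ds * \prod_(i < n) \sum_(k < K | (k : nat) \in V i) p k)%:E.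
Proof.
have mcap m k (W : nat -> set nat) :
    measurable (\bigcap_(i in `I_k) (letter (m + i) @^-1` W i)).
  by apply: fin_bigcap_measurable => [|i _]; [exact: finite_II|exact: measurable_letter_in].
have mcyl es : all (ltn^~ K) es -> measurable (cylinder es).
  by move=> esK; rewrite cylinderE.
elim: n ds V => [|n IH] ds V dsK.
  by rewrite II0 bigcap_set0 setIT big_ord0 mulr1 uniform_prob_cylinder.
have K0 : (0 < K)%N.
  rewrite lt0n; apply: contraTneq (oner_neq0 R) => K0.
  by rewrite -p_sum1 K0 big_ord0 eqxx.
(* This is the next letter as an ordinal. The default is met only outside [0, 1[, which the cylinder
   excludes. *)
pose f u := odflt (Ordinal K0) (insub (letter (size ds) u)) : 'I_K.
have fE u d : 0 <= u < 1 -> (f u = d) <-> (letter (size ds) u = d).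
  move=> /(letter_lt (size ds)) h; rewrite /f insubT/=.
  by split=> [<-//|e]; apply/val_inj.
rewrite [LHS](@measure_fibers _ _ _ U _ f); last 2 first.
- by apply: measurableI; [exact: mcyl|exact: mcap].
- move=> d; rewrite (_ : _ @^-1` _ = letter (size ds) @^-1`
      [set k | odflt (Ordinal K0) (insub k) = d])//.
  exact: measurable_letter_in.
rewrite big_ord_recl mulrCA mulrC big_distrr -sumEFin [RHS]big_mkcond /=.
apply: eq_bigr => d _; case: ifPn => [/set_mem|/negP] Vd; last first.
  rewrite (_ : _ `&` _ = set0) ?measure0//.
  apply/seteqP; split=> // u [[[u01 _] /(_ 0%N isT)]].
  rewrite /= addn0 => Vu /(fE _ _ u01) ud.
  by apply: Vd; rewrite -ud; exact: mem_set.
transitivity (U (cylinder (rcons ds d) `&`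
    \bigcap_(i in `I_n) (letter (size (rcons ds d) + i) @^-1` V i.+1))).
  congr (U _); rewrite cylinder_rcons size_rcons; apply/seteqP; split=> u.
    move=> [[cu Vu] fu]; split; first by split => //; apply/fE; case: cu.
    by move=> i ni; rewrite addSnnS; exact: Vu.
  move=> [[cu fu] Vu]; split; last by apply/fE => //; case: cu.
  split=> // -[_|i ni]; first by rewrite addn0 /= fu.
  by rewrite -addSnnS; exact: Vu.
rewrite (IH _ (V \o S)); last by rewrite all_rcons /= ltn_ord.
by rewrite cylinder_length_rcons mulrAC.
Qed.

Lemma uniform_prob_iid n (V : nat -> set nat) :
  U (\bigcap_(i in `I_n) (letter i @^-1` V i)) =
  (\prod_(i < n) finite_law K p (V i))%E.
Proof.
have := @uniform_prob_letters n [::] V isT; rewrite /= mul1r.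
have -> : (\prod_(i < n) \sum_(k < K | (k : nat) \in V i) p k)%:E =
    (\prod_(i < n) finite_law K p (V i))%E.
  by rewrite -prodEFin; apply: eq_bigr => i _; rewrite finite_lawE.
move=> <-; set A := bigcap _ _.
have mA : measurable A.
  apply: fin_bigcap_measurable => [|i _]; first exact: finite_II.
  exact: measurable_letter_in.
have mC : measurable (cylinder [::]) by rewrite cylinderE.
(* The empty cylinder is [0, 1[; the part of the event outside it is negligible. *)
rewrite setIC [LHS](measureDI U mA mC) -[RHS]add0e; congr (_ + _)%E.
apply: (@subset_measure0 _ _ _ U _ (~` cylinder [::])).
- exact: measurableD.
- exact: measurableC.
- by move=> u [].
- have /= -> := probability_setC (U : probability _ _) mC.
  rewrite [X in (_ - X)%E](_ : _ = 1%E) ?subee//.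
  exact: (@uniform_prob_cylinder [::] isT).
Qed.

End digits.

(** * Measurability of a run, and its dependence on finitely many samples *)

Section algorithm_measurability.
Context {R : realType} (A : algorithm R) (z0 : R * R) (G : nat -> R * R -> R * R).

Lemma measurable_rcons d d' (T : measurableType d) (T' : measurableType d') n
    (h : T -> n.-tuple T') (x : T -> T') :
  measurable_fun setT h -> measurable_fun setT x ->
  measurable_fun setT (fun w => [tuple of rcons (h w) (x w)]).
Proof.
move=> mh mx; apply/measurable_fun_tnthP => i; have [iltn|nlti] := ltnP i n.
  rewrite (_ : _ \o _ = (fun t => tnth t (Ordinal iltn)) \o h).
    by apply: measurableT_comp => //; exact: measurable_tnth.
  apply/funext => w /=; rewrite !(tnth_nth (x w)) /=.
  by rewrite nth_rcons size_tuple iltn.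
rewrite (_ : _ \o _ = x)//; apply/funext => w /=.
have ni : (i : nat) = n by apply/eqP; rewrite eqn_leq nlti -ltnS ltn_ord.
by rewrite (tnth_nth (x w)) /= nth_rcons size_tuple ni ltnn eqxx.
Qed.

Hypothesis mG : forall s, measurable_fun setT (G s).

Lemma measurable_run t :
  measurable_fun setT (fun w : al_rand A => (run z0 G w t).1) /\
  measurable_fun setT (fun w : al_rand A => (run z0 G w t).2).
Proof.
elim: t => [|t [IH1 IH2]] /=; first by split; exact: measurable_cst.
have mwh : measurable_fun setT (fun w : al_rand A => (w, (run z0 G w t).2)).
  exact: measurable_fun_pair.
have ms : measurable_fun setT (fun w : al_rand A =>
    minn (al_sample z0 (w, (run z0 G w t).2)) (run z0 G w t).1).
  apply: (measurable_fun_nat_arg (g := minn)) => //.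
  exact: (measurableT_comp (@al_sample_meas R A z0 t) mwh).
have mx : measurable_fun setT (fun w : al_rand A =>
    al_point z0 (w, (run z0 G w t).2)).
  exact: (measurableT_comp (@al_point_meas R A z0 t) mwh).
split.
- rewrite (_ : (fun _ => _) = (fun w => maxn (run z0 G w t).1
        (minn (al_sample z0 (w, (run z0 G w t).2)) (run z0 G w t).1).+1)).
    exact: (measurable_fun_nat_arg (g := fun a b => maxn a b.+1)).
  by apply/funext => w /=; case: (run z0 G w t).
- rewrite (_ : (fun _ => _) = (fun w => [tuple of rcons (run z0 G w t).2
      (G (minn (al_sample z0 (w, (run z0 G w t).2)) (run z0 G w t).1)
         (al_point z0 (w, (run z0 G w t).2)))])); last first.
    by apply/funext => w /=; case: (run z0 G w t).
  apply: measurable_rcons => //.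
  exact: measurable_fun_nat_arg.
Qed.

Lemma measurable_result :
  measurable_fun setT (fun w : al_rand A => result z0 G w).
Proof.
apply: (measurableT_comp (@al_output_meas R A z0)).
by apply: measurable_fun_pair => //; exact: (measurable_run _).2.
Qed.

End algorithm_measurability.

Lemma run_counter_le {R : realType} (A : algorithm R) z0 G (w : al_rand A) t :
  ((run z0 G w t).1 <= t)%N.
Proof.
elim: t => //= t; case: (run z0 G w t) => m h /= mt.
by rewrite geq_max (leq_trans mt)//= ltnS (leq_trans (geq_minr _ _)).
Qed.

(** A query selects at most the current counter, which [run_counter_le] bounds by the number of
    earlier queries. *)
Lemma eq_run {R : realType} (A : algorithm R) z0 G G' (w : al_rand A) t :
  (forall s, (s < t)%N -> G s = G' s) -> run z0 G w t = run z0 G' w t.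
Proof.
elim: t => //= t IH GG'; rewrite -IH => [|s st]; last by rewrite GG'// ltnW.
have := run_counter_le z0 G w t; case: (run z0 G w t) => m h /= mt.
by rewrite GG'// ltnS (leq_trans (geq_minr _ _)).
Qed.

(** This passes from a bound valid for each value of the internal randomness to its average, by
    linearity of the integral. *)
Lemma weighted_probability_le d (T : measurableType d) (R : realType)
    (P : probability T R) (I : finType) (a : I -> R) (B : I -> set T) (c : R) :
  (forall i, 0 <= a i) -> (forall i, measurable (B i)) ->
  (forall w, \sum_i a i * \1_(B i) w <= c) ->
  (\sum_i (a i)%:E * P (B i) <= c%:E)%E.
Proof.
move=> a0 mB ac.
have m1 i : measurable_fun setT (fun w => \1_(B i) w : R) by exact: measurable_indic.
have -> : (\sum_i (a i)%:E * P (B i) = \int[P]_w (\sum_i a i * \1_(B i) w)%:E)%E.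
  under eq_integral do rewrite -sumEFin.
  rewrite ge0_integral_sum//.
  - apply: eq_bigr => i _; under eq_integral do rewrite EFinM.
    rewrite ge0_integralZl ?lee_fin//; first by rewrite integral_indic// setIT.
    exact: measurableT_comp.
  - by move=> i; apply: measurableT_comp => //; exact: measurable_funM.
  - by move=> i w _; rewrite lee_fin mulr_ge0.
apply: (@le_trans _ _ (\int[P]_w c%:E)%E).
  apply: ge0_le_integral => //.
  - by move=> w _; rewrite lee_fin sumr_ge0// => i _; rewrite mulr_ge0.
  - apply: measurableT_comp => //; apply: measurable_sum => i.
    exact: measurable_funM.
  - by move=> w _; rewrite lee_fin.
by rewrite integral_cst//= probability_setT mule1.
Qed.

(** * Existence of executions *)

Section iid_execution.
Context {R : realType} (K : nat) (p : nat -> R).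
Hypothesis p_gt0 : forall k, 0 < p k.
Hypothesis p_sum1 : \sum_(k < K) p k = 1.

(** The two proofs are arguments so that the probability structure can recover them from the
    term. *)
Definition finite_prob of (forall k, 0 < p k) & \sum_(k < K) p k = 1 :
  set nat -> \bar R := finite_law K p.

HB.instance Definition _ := Measure.on (finite_prob p_gt0 p_sum1).

Let finite_prob_setT : finite_prob p_gt0 p_sum1 setT = 1%E.
Proof.
rewrite /finite_prob finite_lawE// -p_sum1; congr EFin.
by apply: eq_bigl => k; rewrite in_setT.
Qed.

HB.instance Definition _ :=
  Measure_isProbability.Build _ _ _ (finite_prob p_gt0 p_sum1) finite_prob_setT.

(** As [solves] constrains an algorithm only through its executions, one has to be exhibited: the
    internal randomness times a uniform number, whose letters are the samples. *)
Lemma iid_execution (A : algorithm R) (op : R * R -> R * R) (z0 : R * R)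
    (noise : nat -> R * R -> R * R) :
  inhabited (execution A (Problem op z0 (finite_prob p_gt0 p_sum1) noise)).
Proof.
pose S := (al_rand A * measurableTypeR R)%type.
pose Pr : probability S R := (al_law A \x uniform_prob ltr01)%E.
have mi i : measurable_fun setT (letter K p i \o snd : S -> nat).
  by apply: measurableT_comp => //; exact: measurable_letter.
pose rnd : {mfun S >-> al_rand A} :=
  HB.pack (fst : S -> al_rand A) (isMeasurableFun.Build _ _ _ _ _ measurable_fst).
pose idx i : {mfun S >-> nat} :=
  HB.pack (letter K p i \o snd : S -> nat) (isMeasurableFun.Build _ _ _ _ _ (mi i)).
constructor; apply: (@Execution R A
  (Problem op z0 (finite_prob p_gt0 p_sum1) noise) _ S Pr rnd idx) => n U V mU mV.
rewrite -(uniform_prob_iid p_gt0 p_sum1) -product_measure1E//.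
apply: fin_bigcap_measurable => [|i _]; first exact: finite_II.
exact: measurable_letter_in.
Qed.

End iid_execution.

(** * Biased coins compared with fair ones *)

Definition spin {R : realType} (b : bool) : R := if b then 1 else -1.

Definition coin {R : realType} (t : R) (b : bool) : R := (1 + t * spin b) / 2.

Section coins.
Context {R : realType}.
Implicit Types t : R.

Lemma coin_gt0 t b : `|t| < 1 -> 0 < coin t b.
Proof. by rewrite ltr_norml /coin /spin; case: b => /andP[*]; lra. Qed.

Lemma coin_sum1 t : \sum_b coin t b = 1.
Proof. by rewrite big_bool /coin /spin /=; lra. Qed.

(** This is the Cauchy-Schwarz inequality for the likelihood ratio [1 + t * spin b] against the fair
    coin, whose second moment is [1 + t ^+ 2]. *)
Lemma coin_mean_sqr t (theta : R) (x : bool -> R) : `|t| <= theta ->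
  (\sum_b coin t b * x b) ^+ 2 <= (1 + theta ^+ 2) * \sum_b coin 0 b * x b ^+ 2.
Proof.
move=> tth; have tt : t ^+ 2 <= theta ^+ 2.
  by rewrite -(real_normK (num_real t)) lerXn2r ?nnegrE// (le_trans _ tth).
rewrite !big_bool /coin /spin /=.
(* By Lagrange's identity, a quarter of this square is the defect of the inequality for [t]; the
   next fact passes from [t] to [theta]. *)
have := sqr_ge0 ((1 + t) * x false - (1 - t) * x true).
have : 0 <= (theta ^+ 2 - t ^+ 2) * (x true ^+ 2 + x false ^+ 2).
  by rewrite mulr_ge0 ?subr_ge0// addr_ge0 ?sqr_ge0.
nra.
Qed.

Lemma mean_linear (I : finType) (p : I -> bool -> R) a b f g :
  mean p (fun w => a * f w + b * g w) = a * mean p f + b * mean p g.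
Proof.
rewrite /mean !big_distrr -big_split; apply: eq_bigr => w _ /=; ring.
Qed.

Lemma ler_mean (I : finType) (p : I -> bool -> R) f g :
  (forall c b, 0 <= p c b) -> (forall w, f w <= g w) -> mean p f <= mean p g.
Proof.
by move=> p0 fg; apply: ler_sum => w _; rewrite ler_wpM2l ?prodr_ge0.
Qed.

Lemma mean_coin (I : finType) (t : I -> R) (c : I) :
  mean (fun c => coin (t c)) (fun w => spin (w c)) = t c.
Proof.
rewrite (mean_query _ c (fun b _ => spin b)) big_bool !mean_cst.
- by rewrite /coin /spin /=; lra.
- by apply: condition_sum1 => c'; exact: coin_sum1.
- by apply: condition_sum1 => c'; exact: coin_sum1.
Qed.

End coins.

(** * The hard instances and their admissibility *)

Section hard_instances.
Context {R : realType} (n : nat) (theta : R).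

Definition values (e : 'I_n.+1 -> bool) (k : nat) : R := spin (e (inord (minn k n))).

Definition biased_coin (j : nat) (c : 'I_n.+1) : bool -> R :=
  coin (bias theta n j c).

(** Sign patterns are numbered because [finite_law] lives on [nat]. The default pattern keeps
    [index_weight] positive at every integer. *)
Definition decode (k : nat) : {ffun 'I_n.+1 -> bool} :=
  nth [ffun=> false] (enum {: {ffun 'I_n.+1 -> bool}}) k.

Definition index_weight (j k : nat) : R := \prod_c biased_coin j c (decode k c).

Definition hard_op (j : nat) (z : R * R) : R * R := (interp (bias theta n j) z.1, 0).

Definition hard_noise (j k : nat) (z : R * R) : R * R :=
  (interp (values (decode k)) z.1 - interp (bias theta n j) z.1, 0).

Lemma sum_decode (F : {ffun 'I_n.+1 -> bool} -> R) :
  \sum_(k < #|{: {ffun 'I_n.+1 -> bool}}|) F (decode k) = \sum_e F e.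
Proof.
rewrite -[RHS]big_enum /= (big_nth [ffun=> false]) big_mkord.
by rewrite -cardE.
Qed.

Lemma values_lipschitz e k : `|values e k.+1 - values e k| <= 2.
Proof.
by rewrite /values /spin; do 2!case: ifP => _; rewrite ler_norml; apply/andP; split; lra.
Qed.

(** Interpolation is linear in the values at the nodes, so it commutes with the mean; this is what
    centres the noise. *)
Lemma mean_interp_values j x :
  mean (biased_coin j) (fun e => interp (values e) x) = interp (bias theta n j) x.
Proof.
have mv k : mean (biased_coin j) (fun e => values e k) = bias theta n j k.
  rewrite mean_coin /bias inordK ?ltnS ?geq_minr//.
  by rewrite (minn_idPl (geq_minr k n)).
rewrite /interp; set k := Num.truncn _; set r := _ - k%:R.
rewrite (_ : (fun _ => _) = fun e : {ffun _ -> bool} =>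
    (1 - r) * values e k + r * values e k.+1).
  by rewrite mean_linear !mv; ring.
by apply/funext => e; ring.
Qed.

Hypothesis theta_gt0 : 0 < theta.
Hypothesis theta_lt1 : theta < 1.

Lemma biased_coin_gt0 j c b : 0 < biased_coin j c b.
Proof. by rewrite coin_gt0// (le_lt_trans (bias_le _ _ _ _))// ltW. Qed.

Lemma index_weight_gt0 j k : 0 < index_weight j k.
Proof. by apply: prodr_gt0 => c _; exact: biased_coin_gt0. Qed.

Lemma index_weight_sum1 j :
  \sum_(k < #|{: {ffun 'I_n.+1 -> bool}}|) index_weight j k = 1.
Proof.
rewrite (sum_decode (fun e => \prod_c biased_coin j c (e c))).
by rewrite -(bigA_distr_bigA (biased_coin j)) big1// => c _; exact: coin_sum1.
Qed.

Definition hard_problem (j : nat) : problem R :=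
  Problem (hard_op j) (0, 0)
    (finite_prob (index_weight_gt0 j) (index_weight_sum1 j)) (hard_noise j).

Lemma enorm0 (a : R) : enorm (a, 0) = `|a|.
Proof. by rewrite /enorm /dotp /= mulr0 addr0 -expr2 sqrtr_sqr. Qed.

Lemma ler_norm_enorm (x y : R * R) : `|x.1 - y.1| <= enorm (x - y).
Proof.
by rewrite /enorm /dotp /= -sqrtr_sqr ler_wsqrtr// expr2 lerDl -expr2 sqr_ge0.
Qed.

Lemma hard_noise_lipschitz j k x y :
  `|(hard_noise j k x).1 - (hard_noise j k y).1| <= 4 * `|x.1 - y.1|.
Proof.
rewrite /hard_noise /= !interpB; apply: interp_lipschitz => i.
have := values_lipschitz (decode k) i; have := bias_incr n j i (ltW theta_gt0).
have := theta_lt1.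
by rewrite !ler_norml => ? /andP[? ?] /andP[? ?]; apply/andP; split; lra.
Qed.

Lemma hard_noise_bounded j k z : `|(hard_noise j k z).1| <= 2.
Proof.
rewrite /hard_noise /= interpB; apply: interp_bounded => i.
have := theta_lt1; have := bias_le n j i (ltW theta_gt0); rewrite /values /spin.
by case: ifP => _; rewrite !ler_norml => /andP[? ?] ?; apply/andP; split; lra.
Qed.

Lemma interp_bias_lipschitz j x y :
  `|interp (bias theta n j) x - interp (bias theta n j) y| <= theta * `|x - y|.
Proof. by apply: interp_lipschitz => k; rewrite bias_incr// ltW. Qed.

Lemma hard_op_zero j : (j <= n)%N -> hard_op j (j%:R, 0) = 0.
Proof.
move=> jn; rewrite /hard_op /interp /= max_r// natrK subrr mulr0 addr0.
by rewrite /bias (minn_idPl jn) ltnn eqxx.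
Qed.

Lemma expectation_hard j (g : nat -> R) :
  ('E_(pb_law (hard_problem j))[g] =
   (\sum_(k < #|{: {ffun 'I_n.+1 -> bool}}|) index_weight j k * g k)%:E)%E.
Proof.
rewrite unlock; exact: integral_finite_law (index_weight_gt0 j) _.
Qed.

Lemma expectation_hard_le j (g : nat -> R) (c : R) : (forall k, g k <= c) ->
  ('E_(pb_law (hard_problem j))[g] <= c%:E)%E.
Proof.
move=> gc; rewrite expectation_hard lee_fin -[leRHS]mul1r -(index_weight_sum1 j).
rewrite big_distrl; apply: ler_sum => k _.
by rewrite ler_wpM2l// ltW// index_weight_gt0.
Qed.

(** For every sample the noise is bounded by [1 + theta <= 2] and its Lipschitz constant is at most
    [2 + theta <= 4]; the operator is [theta]-Lipschitz, and its zero at [j] is within [n] of the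
    origin. *)
Lemma hard_problem_admissible j : (j <= n)%N ->
  admissible 4 n.+1%:R 2 4 (hard_problem j).
Proof.
move=> jn; split => /=.
- move=> x y; rewrite /dotp /hard_op /= subrr mul0r addr0.
  have h := interp_homo (bias_homo n j (ltW theta_gt0)).
  have [xy|/ltW xy] := leP x.1 y.1.
    by rewrite -mulrNN mulr_ge0// oppr_ge0 subr_le0 ?h.
  by rewrite mulr_ge0// subr_ge0 ?h.
- move=> x y; rewrite /hard_op (_ : _ - _ =
      (interp (bias theta n j) x.1 - interp (bias theta n j) y.1, 0)).
    rewrite enorm0; apply: le_trans (interp_bias_lipschitz _ _ _) _.
    by rewrite ler_pM// ?(ltW theta_gt0)// ?ler_norm_enorm//; have := theta_lt1; lra.
  by congr pair; rewrite /= subrr.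
- exists (j%:R, 0); split; first exact: hard_op_zero.
  rewrite (_ : _ - _ = (- j%:R, 0)); last by congr pair; rewrite /= ?subrr ?sub0r.
  by rewrite enorm0 normrN normr_nat ler_nat ltnW.
- apply: (measurable_uncurry_nat (g := hard_noise j)) => k.
  apply: measurable_fun_pair => //.
  apply: (measurableT_comp (f := fun x =>
    interp (values (decode k)) x - interp (bias theta n j) x)) => //.
  apply: measurable_funB; apply: continuous_measurable_fun.
    exact: continuous_interp (values_lipschitz _).
  by apply: (continuous_interp (a := theta)) => i; rewrite bias_incr// ltW.
split=> [z|z|x y].
- split; last first.
    by rewrite expectation_hard big1// => k _; rewrite mulr0.
  rewrite expectation_hard; congr EFin.
  rewrite (sum_decode (fun e => (\prod_c biased_coin j c (e c)) *
    (interp (values e) z.1 - interp (bias theta n j) z.1))).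
  under eq_bigr do rewrite mulrBr.
  rewrite sumrB -big_distrl /= -(bigA_distr_bigA (biased_coin j)).
  rewrite (big1 _ _ _ (fun c _ => coin_sum1 _)) mul1r.
  by rewrite [X in X - _]mean_interp_values subrr.
- apply: expectation_hard_le => k; rewrite /hard_noise enorm0.
  by rewrite lerXn2r ?nnegrE// hard_noise_bounded.
- apply: expectation_hard_le => k.
  rewrite (_ : _ - _ = ((hard_noise j k x).1 - (hard_noise j k y).1, 0)); last first.
    by congr pair; rewrite /= subrr.
  rewrite enorm0 -exprMn lerXn2r ?nnegrE ?mulr_ge0 ?sqrtr_ge0//.
  apply: le_trans (hard_noise_lipschitz _ _ _ _) _.
  by rewrite ler_wpM2l// ler_norm_enorm.
Qed.

End hard_instances.

(** * Probability of success on a hard instance *)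

Lemma measurable_fun_fibers d d' (T : measurableType d) (T' : measurableType d')
    (I : finType) (f : T -> I) (g : I -> T -> T') :
  (forall i, measurable (f @^-1` [set i])) ->
  (forall i, measurable_fun setT (g i)) -> measurable_fun setT (fun x => g (f x) x).
Proof.
move=> mf mg _ Y mY; rewrite setTI.
have -> : (fun x => g (f x) x) @^-1` Y =
    \bigcup_(i in [set: I]) (f @^-1` [set i] `&` g i @^-1` Y).
  by apply/seteqP; split=> [x Yx|x [i _ [/= <-]]//]; exists (f x).
apply: fin_bigcup_measurable => // i _; apply: measurableI => //.
by rewrite -[_ @^-1` _]setTI; exact: mg.
Qed.

Section success_probability.
Context {R : realType} (n : nat) (theta : R) (A : algorithm R).
Hypothesis theta_gt0 : 0 < theta.
Hypothesis theta_lt1 : theta < 1.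

(* One spare sample keeps the index type inhabited when the budget is zero. *)
Notation bits := {ffun 'I_(al_budget A).+1 * 'I_n.+1 -> bool}.

(** Row [s] of a finite table holds the signs of sample [s]. Rows beyond the budget, which [inord]
    sends to row 0, are never read by a run. *)
Definition bits_op (b : bits) (s : nat) (z : R * R) : R * R :=
  (interp (values (fun c => b (inord s, c))) z.1, 0).

Definition hit (j : nat) (b : bits) : set (al_rand A) :=
  [set w | interp (bias theta n j) (result (0, 0) (bits_op b) w).1 ^+ 2
           < (theta / 2) ^+ 2].

Lemma measurable_op_result j (b : bits) : measurable_fun setT (fun w : al_rand A =>
  interp (bias theta n j) (result (0, 0) (bits_op b) w).1 ^+ 2).
Proof.
apply: measurable_funX.
apply: (measurableT_comp (f := interp (bias theta n j))).
  apply: continuous_measurable_fun; apply: (continuous_interp (a := theta)) => i.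
  by rewrite bias_incr// ltW.
apply: (measurableT_comp measurable_fst); apply: measurable_result => s.
apply: measurable_fun_pair => //.
apply: (measurableT_comp (f := interp _)) => //.
apply: continuous_measurable_fun.
exact: continuous_interp (values_lipschitz _).
Qed.

Lemma measurable_hit j b : measurable (hit j b).
Proof.
rewrite /hit -[X in measurable X]setTI.
exact: (measurable_fun_ltr (measurable_op_result j b) (measurable_cst _)
  measurableT (Y := [set true]) _).
Qed.

(** By Markov's inequality failure has probability at most 1/4, since [theta ^+ 2 / 16] is a quarter
    of the threshold [(theta / 2) ^+ 2]. Splitting along the sign tables and using [ex_indep] then
    turns the execution into a finite sum. *)
Lemma hit_probability_ge j (X : execution A (hard_problem n theta_gt0 theta_lt1 j)) :
  (expected_sq_residual X <= (theta ^+ 2 / 16)%:E)%E ->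
  ((3 / 4)%:E <= \sum_(b : bits)
     (\prod_sc biased_coin theta j sc.2 (b sc))%:E * al_law A (hit j b))%E.
Proof.
set T := al_budget A => small.
pose code (u : ex_space X) : bits :=
  [ffun sc : 'I_T.+1 * 'I_n.+1 => @decode n (ex_index X sc.1 u) sc.2].
pose row (b : bits) (s : nat) : set nat :=
  [set k | forall c, @decode n k c = b (inord s, c)].
have codeE b : code @^-1` [set b] =
    \bigcap_(s in `I_T.+1) (ex_index X s @^-1` row b s).
  apply/seteqP; split=> [u /= <- s sT c|u ob /=].
    by rewrite ffunE /= inordK.
  apply/ffunP => -[s c]; rewrite ffunE /= (ob s (ltn_ord s)).
  by rewrite inord_val.
have mcode b : measurable (code @^-1` [set b]).
  rewrite codeE; apply: fin_bigcap_measurable => [|s _]; first exact: finite_II.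
  by rewrite -[_ @^-1` _]setTI; exact: measurable_funPT.
(* The bias cancels between operator and noise, so the answers, and with them the result, depend on
   the samples through the table only. *)
have resultE (u : ex_space X) :
    result (pb_start (hard_problem n theta_gt0 theta_lt1 j))
      (fun s => sampled_op (ex_index X s u)) (ex_rand X u) =
    result (0, 0) (bits_op (code u)) (ex_rand X u).
  rewrite /result (@eq_run _ _ _ _ (bits_op (code u)))// => s sT.
  apply/funext => z; rewrite /sampled_op /bits_op /=; congr pair; rewrite /= ?addr0//.
  rewrite addrCA subrr addr0; congr (interp _ _); apply/funext => k.
  by rewrite /values ffunE /= inordK// ltnW.
pose g (u : ex_space X) :=
  interp (bias theta n j) (result (0, 0) (bits_op (code u)) (ex_rand X u)).1 ^+ 2.
have residualE : expected_sq_residual X = (\int[ex_prob X]_u (g u)%:E)%E.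
  rewrite /expected_sq_residual unlock; apply: eq_integral => u _.
  by rewrite resultE /residual /= enorm0 real_normK ?num_real.
have mg : measurable_fun setT g.
  apply: (measurable_fun_fibers (g := fun b u =>
    interp (bias theta n j) (result (0, 0) (bits_op b) (ex_rand X u)).1 ^+ 2)) => // b.
  by apply: (measurableT_comp (measurable_op_result j b)).
pose good : set (ex_space X) := [set u | g u < (theta / 2) ^+ 2].
have mgood : measurable good.
  rewrite -[good]setTI.
  exact: (measurable_fun_ltr mg (measurable_cst _) measurableT (Y := [set true]) _).
have good_ge : ((3 / 4)%:E <= ex_prob X good)%E.
  have : (((theta / 2) ^+ 2)%:E * ex_prob X (~` good) <= (theta ^+ 2 / 16)%:E)%E.
    apply: le_trans small; rewrite residualE.
    have mbad := measurableC mgood.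
    have mind : measurable_fun setT (fun u => \1_(~` good) u : R).
      exact: measurable_indic.
    have -> : ex_prob X (~` good) = (\int[ex_prob X]_u (\1_(~` good) u)%:E)%E.
      by rewrite integral_indic// setIT.
    rewrite -ge0_integralZl ?lee_fin ?sqr_ge0//; last first.
      exact: measurableT_comp.
    apply: ge0_le_integral => //.
    - by move=> u _; rewrite lee_fin mulr_ge0 ?sqr_ge0.
    - by apply: measurable_funeM; exact: measurableT_comp.
    - exact: measurableT_comp.
    - move=> u _; rewrite lee_fin indicE; case: (boolP (u \in _)) => [/set_mem/negP|_].
        by rewrite -leNgt mulr1.
      by rewrite mulr0 sqr_ge0.
  rewrite probability_setC// -(fineK (fin_num_measure (ex_prob X) _ mgood)).
  rewrite -EFinB -EFinM !lee_fin => h.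
  have := exprn_gt0 2 theta_gt0; nra.
apply: le_trans good_ge _.
rewrite (@measure_fibers _ _ _ (ex_prob X) _ code)// le_eqVlt; apply/orP; left; apply/eqP.
apply: eq_bigr => b _.
transitivity (ex_prob X (ex_rand X @^-1` hit j b `&`
    \bigcap_(s in `I_T.+1) (ex_index X s @^-1` row b s))).
  rewrite -codeE; congr (ex_prob X _); apply/seteqP.
  by split=> u [+ /= co]; rewrite /good /hit /g /= co.
rewrite (ex_indep X T.+1 (measurable_hit j b) (V := row b)); last by [].
rewrite muleC; congr (_ * _)%E.
(* A row determines the whole sign pattern, so a single term of the law remains. *)
have lawE s : pb_law (hard_problem n theta_gt0 theta_lt1 j) (row b s) =
    (\prod_c biased_coin theta j c (b (inord s, c)))%:E.
  rewrite /= /finite_prob finite_lawE; last exact: index_weight_gt0.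
  congr EFin; rewrite big_mkcond /=.
  pose e0 : {ffun 'I_n.+1 -> bool} := [ffun c => b (inord s, c)].
  rewrite (eq_bigr (fun k : 'I__ => if decode n k == e0
      then \prod_c biased_coin theta j c (decode n k c) else 0)); last first.
    move=> k _; congr (if _ then _ else _); apply/idP/eqP => [/set_mem rk|ke].
      by apply/ffunP => c; rewrite rk ffunE.
    by apply/mem_set => c; rewrite ke ffunE.
  rewrite (sum_decode (fun e => if e == e0
    then \prod_c biased_coin theta j c (e c) else 0)) -big_mkcond big_pred1_eq.
  by apply: eq_bigr => c _; rewrite ffunE.
transitivity (\prod_(s < T.+1) (\prod_c biased_coin theta j c (b (inord s, c)))%:E)%E.
  by apply: eq_bigr => s _; exact: lawE.
rewrite prodEFin; congr EFin.
rewrite pair_bigA; apply: eq_bigr => -[s c] _ /=.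
by rewrite inord_val.
Qed.

End success_probability.

(** * Counting the instances that one algorithm can solve *)

Section counting.
Context {R : realType} (n : nat) (theta : R) (A : algorithm R).
Hypothesis theta_gt0 : 0 < theta.
Hypothesis theta_lt1 : theta < 1.

Notation coord := ('I_(al_budget A).+1 * 'I_n.+1)%type.

(** Once the internal randomness is fixed, the run is a deterministic function of the signs, and a
    query reads those at the two ends of one cell. *)
Lemma hit_decision_tree j (w : al_rand A) :
  decision_tree (al_budget A).*2
    (fun b : {ffun coord -> bool} => \1_(hit theta j b) w : R).
Proof.
rewrite -[_.*2]addn0.
pose psi (st : nat * (al_budget A).-tuple (R * R)) : R :=
  (interp (bias theta n j) (al_output (0, 0) (w, st.2)).1 ^+ 2 < (theta / 2) ^+ 2)%R%:R.
rewrite (_ : (fun _ => _) = fun b : {ffun coord -> bool} =>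
    psi (run (0, 0) (bits_op b) w (al_budget A))); last first.
  apply/funext => b; rewrite indicE /psi; congr (nat_of_bool _)%:R.
  by apply/idP/idP => [/set_mem//|h]; apply/mem_set.
apply: (@run_decision_tree _ _ A (0, 0) (fun b => bits_op b) w _ 0
  (fun st _ => psi st)) => [s z|st]; last exact: dt_leaf.
set k := Num.truncn (Num.max 0 z.1).
exists (inord s, inord (minn k n)), (inord s, inord (minn k.+1 n)),
  (fun b1 b2 => (spin b1 + (spin b2 - spin b1) * (Num.max 0 z.1 - k%:R), 0)).
by [].
Qed.

(** Fair signs have the same law for all [j], and under it the hits are disjoint events by
    [sum_close_le1]: their fair probabilities add up to at most 1. *)
Lemma sum_hit_le (w : al_rand A) :
  \sum_(jb : 'I_n.+1 * {ffun coord -> bool})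
    (\prod_sc biased_coin theta jb.1 sc.2 (jb.2 sc)) * \1_(hit theta jb.1 jb.2) w <=
  n.+1%:R / 4 + (1 + theta ^+ 2) ^+ (al_budget A).*2.
Proof.
rewrite -(pair_bigA _ (fun (j : 'I_n.+1) (b : {ffun coord -> bool}) =>
  (\prod_sc biased_coin theta j sc.2 (b sc)) * \1_(hit theta j b) w)) /=.
pose fair (c : coord) := coin (0 : R).
set M := 1 + theta ^+ 2.
have M1 : 1 <= M by rewrite lerDl sqr_ge0.
have fair0 (c : coord) b : 0 <= fair c b by rewrite ltW// coin_gt0// normr0.
have fair1 (c : coord) : \sum_b fair c b = 1 by exact: coin_sum1.
(* [x <= 1 / 4 + x ^+ 2] makes the second moment bound linear in the fair
   probabilities, which can then be summed over [j]. *)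
have hit_le (j : 'I_n.+1) :
    mean (fun sc : coord => biased_coin theta j sc.2) (fun b => \1_(hit theta j b) w) <=
    4^-1 + M ^+ (al_budget A).*2 * mean fair (fun b => \1_(hit theta j b) w).
  set x := mean _ _.
  have : x ^+ 2 <=
      M ^+ (al_budget A).*2 * mean fair (fun b => \1_(hit theta j b) w).
    apply: le_trans (decision_tree_mean_sqr (hit_decision_tree j w) M1 _ fair1 fair0 _) _.
    - by move=> c; exact: coin_sum1.
    - by move=> c y; apply: coin_mean_sqr; rewrite bias_le// ltW.
    rewrite ler_wpM2l ?exprn_ge0 ?(le_trans ler01)// ler_mean// => b.
    by rewrite indicE; case: (_ \in _); rewrite ?expr1n ?expr0n.
  have := sqr_ge0 (x - 2^-1); nra.
apply: le_trans (ler_sum _ (fun j _ => hit_le j)) _.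
rewrite big_split /= sumr_const card_ord -[4^-1 *+ _]mulr_natl lerD2l -mulr_sumr.
rewrite ler_piMr ?exprn_ge0 ?(le_trans ler01)//.
rewrite /mean exchange_big /= -[leRHS](mean_cst 1 fair1); apply: ler_sum => b _.
rewrite -mulr_sumr ler_wpM2l ?prodr_ge0//.
apply: le_trans (sum_close_le1 n (result (0, 0) (bits_op b) w).1 (ltW theta_gt0)).
apply: ler_sum => j _; rewrite indicE ler_nat.
by case: (boolP (w \in _)) => // /set_mem; rewrite /hit /= => ->.
Qed.

(** The success probabilities add up to at least [3 / 4 * (n + 1)], of which the term [n.+1%:R / 4]
    of [sum_hit_le] absorbs a third. *)
Lemma budget_lower_bound :
  solves 4 n.+1%:R 2 4 (theta ^+ 2 / 16) A ->
  n.+1%:R <= 2 * (1 + theta ^+ 2) ^+ (al_budget A).*2.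
Proof.
move=> solvesA.
have hit_ge (j : 'I_n.+1) : ((3 / 4)%:E <= \sum_(b : {ffun coord -> bool})
     (\prod_sc biased_coin theta j sc.2 (b sc))%:E * al_law A (hit theta j b))%E.
  have [X] : inhabited (execution A (hard_problem n theta_gt0 theta_lt1 j)).
    exact: iid_execution.
  apply: (hit_probability_ge (X := X)); apply: solvesA.
  by apply: hard_problem_admissible; rewrite -ltnS.
have : ((\sum_(j < n.+1) 3 / 4)%:E <=
    (n.+1%:R / 4 + (1 + theta ^+ 2) ^+ (al_budget A).*2)%:E)%E.
  rewrite -sumEFin; apply: le_trans (lee_sum _ (fun j _ => hit_ge j)) _.
  rewrite pair_bigA /=; apply: weighted_probability_le sum_hit_le => jb.
  - by apply: prodr_ge0 => c _; rewrite ltW// biased_coin_gt0.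
  - exact: measurable_hit.
rewrite lee_fin sumr_const card_ord -mulr_natl; lra.
Qed.

End counting.

Unset Implicit Arguments.

Theorem theorem5p1 (R : realType) :
  ~ (exists C : R, 0 < C /\
      forall L D sigma LDelta eps : R,
        0 < L -> 0 < D -> 0 <= sigma -> 0 <= LDelta -> LDelta <= L ->
        0 < eps ->
        exists A : algorithm R,
          (al_budget A)%:R <= C * (L * D / Num.sqrt eps + sigma ^+ 2 / eps) /\
          solves L D sigma LDelta eps A).
Proof.
move=> [C [C0 solvable]].
(* The lower bound will give [n + 1 <= 2 * expR (160 * C)] whatever [n] is. The successor ensures
   [1 < n + 1], hence [theta < 1]. *)
pose n := (Num.truncn (2 * expR (160 * C))).+1.
have nlarge : 2 * expR (160 * C) < n.+1%:R.
  by apply: lt_trans (truncnS_gt _) _; rewrite ltr_nat.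
pose theta : R := n.+1%:R^-1.
have theta_gt0 : 0 < theta by rewrite invr_gt0.
have theta_lt1 : theta < 1 by rewrite invf_lt1// ltr1n.
have [||||||A [budget solvesA]] := solvable 4 n.+1%:R 2 4 (theta ^+ 2 / 16) => //.
  by rewrite divr_gt0// exprn_gt0.
have := budget_lower_bound theta_gt0 theta_lt1 solvesA.
apply/negP; rewrite -ltNge; apply: le_lt_trans nlarge; rewrite ler_pM2l//.
apply: (@le_trans _ _ (expR (theta ^+ 2 * (al_budget A).*2%:R))).
  by rewrite expRM_natr lerXn2r ?nnegrE ?expR_ge0 ?addr_ge0 ?sqr_ge0// expR_ge1Dx.
rewrite ler_expR.
have sqrt_eps : Num.sqrt (theta ^+ 2 / 16) = theta / 4.
  rewrite (_ : _ / _ = (theta / 4) ^+ 2); last by field.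
  by rewrite sqrtr_sqr ger0_norm// divr_ge0// ltW.
(* With [D = 1 / theta] both terms have order [theta ^- 2]: they are 16 and 64 times it. Two signs
   per query turn 80 into 160. *)
have budget_value : 4 * n.+1%:R / (theta / 4) + 2 ^+ 2 / (theta ^+ 2 / 16) = 80 / theta ^+ 2.
  have -> : n.+1%:R = theta^-1 by rewrite invrK.
  by field; rewrite gt_eqF.
rewrite -muln2 natrM; move: budget; rewrite sqrt_eps budget_value => budget.
have : theta ^+ 2 * (al_budget A)%:R <= theta ^+ 2 * (C * (80 / theta ^+ 2)).
  by rewrite ler_wpM2l// sqr_ge0.
have -> : theta ^+ 2 * (C * (80 / theta ^+ 2)) = 80 * C.
  by field; rewrite gt_eqF.
by rewrite mulrA; lra.
Qed.
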